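(* Let $\operatorname{nz}(N)$ denote the number of indices $i$ with $1\le i\le N$ such that $a_i=1$, where $\sqrt{2}=\sum_{i} a_i 2^{-i}$ is the binary expansion of $\sqrt{2}$ with digits $a_i\in\{0,1\}$. For every $\epsilon>0$ there are infinitely many positive integers $N$ such that \[ \operatorname{nz}(N)\ge\left(\frac{2}{\sqrt{2\sqrt{2}-1}}-\epsilon\right)N^{1/2}. \]
   Context: The binary expansion $\sqrt{2}=\sum_i a_i2^{-i}$ with $a_i\in\{0,1\}$; $\operatorname{nz}(N)$ counts the nonzero digits among the first $N$ binary digits after the binary point. *)

(* Defs.v *)
From mathcomp Require Export all_boot all_order all_algebra.
From mathcomp Require Export boolp classical_sets functions cardinality.
From mathcomp Require Export reals topology normedtype sequences.
Export Order.TTheory GRing.Theory Num.Theory.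
Export numFieldNormedType.Exports.

Set Implicit Arguments.
Unset Strict Implicit.
Unset Printing Implicit Defensive.

Local Open Scope classical_set_scope.
Local Open Scope ring_scope.

(* Digits are indexed from 0, [a 0] being the units digit, so this covers the
   reals [0 <= x <= 2]. A dyadic rational may have two expansions in this
   sense; an irrational number has exactly one. *)
Definition binary_expansion (R : realType) (x : R) (a : nat -> bool) : Prop :=
  series (fun i : nat => (a i)%:R / 2 ^+ i : R) @ \oo --> x.

Definition nz (a : nat -> bool) (N : nat) : nat :=
  (\sum_(1 <= i < N.+1 | a i) 1)%N.

(* Main.v *)
Require Import Defs.
From mathcomp Require Import zify ring lra.

(* Write [A n] for the number of ones among the digits [0..n] and [r n] for the
   number of ordered pairs of ones whose positions add up to [n]. Squaring the
   expansion gives [2 = \sum_n r n / 2^n]. The carries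
   [T n = 2^(n+1) - \sum_(k <= n) r k 2^(n-k)] are positive integers with
   [T (n+1) + r (n+1) = 2 T n]. Swapping the two positions of a pair shows that
   [r n], hence [T n], is even unless [n] is twice the position of a one, so that
   [T n >= 2] for almost all [n], while [T n <= A n + 2]. Summing the recurrence
   gives [\sum_(k <= N) r k >= 2N - O(A N)].
   A pair with sum at most [2h] has an entry at most [h], so this sum for [N = 2h]
   is at most [2 A(2h) A(h) - A(h)^2]. If [A n <= c sqrt n + K] for all [n], this
   is [c^2 (2 sqrt 2 - 1) h + O(sqrt h)], whence [c^2 (2 sqrt 2 - 1) >= 4]. *)

Set Implicit Arguments.
Unset Strict Implicit.
Unset Printing Implicit Defensive.

Local Open Scope classical_set_scope.
Local Open Scope ring_scope.

(** * Partial sums and the Cauchy square of a sequence *)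

Section Convolution.

Variables (R : pzSemiRingType) (f : nat -> R).

Definition psum (n : nat) : R := \sum_(i < n.+1) f i.

Definition conv (n : nat) : R := \sum_(i < n.+1) f i * f (n - i)%N.

Lemma psumS n : psum n.+1 = psum n + f n.+1.
Proof. by rewrite /psum big_ord_recr. Qed.

(** Pairs with sum at most [n] are regrouped by their first entry. *)
Lemma sum_conv n : \sum_(k < n.+1) conv k = \sum_(i < n.+1) f i * psum (n - i).
Proof.
elim: n => [|n IHn].
  by rewrite !big_ord1 /conv /psum !big_ord1.
rewrite big_ord_recr IHn [RHS]big_ord_recr /= subnn [psum 0]big_ord1.
rewrite [conv n.+1]big_ord_recr /= subnn addrA -big_split /=; congr (_ + _).
apply: eq_bigr => i _.
have le_in : (i <= n)%N by rewrite -ltnS.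
by rewrite -mulrDr subSn // psumS.
Qed.

End Convolution.

(** * Counting pairs of ones in a digit sequence *)

Section Digits.

Variable a : nat -> bool.

Local Notation dig := (fun i : nat => nat_of_bool (a i)).
Local Notation A := (psum dig).
Local Notation r := (conv dig).

Lemma psum_dig_homo : {homo A : m n / (m <= n)%N}.
Proof.
apply: homo_leq => [n|m n p|n]; [exact: leqnn|exact: leq_trans|].
by rewrite psumS leq_addr.
Qed.

Lemma psum_dig_nz n : A n = (a 0 + nz a n)%N.
Proof.
rewrite /psum /nz -(big_mkord xpredT dig) big_ltn //; congr (_ + _)%N.
by rewrite [RHS]big_mkcond /=; apply: eq_bigr => i _; case: (a i).
Qed.

(* Swapping the two positions of a pair leaves only the diagonal pair. *)
Lemma odd_conv_dig n : odd (r n) -> a n./2.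
Proof.
pose g (i : 'I_n.+1) := (a i * a (n - i))%N.
have gE (i : 'I_n.+1) : g (rev_ord i) = g i.
  have le_in : (i <= n)%N by rewrite -ltnS.
  by rewrite /g /= subSS subKn // mulnC.
have -> : r n = (\sum_i g i)%N by [].
rewrite (bigID (fun i : 'I_n.+1 => (i < n - i)%N)) /=.
rewrite [X in (_ + X)%N](bigID (fun i : 'I_n.+1 => (n - i < i)%N)) /=.
rewrite addnA.
have -> : (\sum_(i < n.+1 | ~~ (i < n - i) && (n - i < i)) g i =
           \sum_(i < n.+1 | (i < n - i)) g i)%N.
  rewrite (reindex_inj rev_ord_inj) /=; apply: eq_big => [i|i _]; last exact: gE.
  have := ltn_ord i; rewrite !subSS; lia.
rewrite addnn oddD odd_double /=.
case: (boolP (a n./2)) => // Na.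
rewrite big1 // => i /andP[].
rewrite -!leqNgt => h1 h2.
have -> : g i = (a n./2 * a (n - i))%N.
  by rewrite /g; have -> : nat_of_ord i = n./2 by have := ltn_ord i; lia.
by rewrite (negbTE Na).
Qed.

(** A first position up to [h] has at most [A h.*2] partners. Each of the [A h.*2 - A h] later ones
    forces its partner below [h], leaving at most [A h]. *)
Lemma sum_conv_dig_le h :
  (\sum_(k < h.*2.+1) r k + A h ^ 2 <= 2 * A h.*2 * A h)%N.
Proof.
rewrite [X in (X + _)%N](sum_conv dig).
have split_sum (F : nat -> nat) : (\sum_(i < h.*2.+1) F i =
    \sum_(i < h.+1) F i + \sum_(h.+1 <= i < h.*2.+1) F i)%N.
  by rewrite -(big_mkord xpredT) (@big_cat_nat _ _ _ h.+1) ?big_mkord //=; lia.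
have E2 : A h.*2 = (A h + \sum_(h.+1 <= i < h.*2.+1) dig i)%N.
  exact: (split_sum dig).
have -> : (\sum_(i < h.*2.+1) dig i * A (h.*2 - i) : nat) =
    (\sum_(i < h.+1) dig i * A (h.*2 - i) +
     \sum_(h.+1 <= i < h.*2.+1) dig i * A (h.*2 - i))%N.
  exact: (split_sum (fun i => dig i * A (h.*2 - i))%N).
have le1 : (\sum_(i < h.+1) dig i * A (h.*2 - i) <= A h * A h.*2)%N.
  rewrite /psum [X in (_ <= X)%N]big_distrl /=; apply: leq_sum => i _.
  by rewrite leq_mul2l psum_dig_homo ?orbT // leq_subr.
have le2 : (\sum_(h.+1 <= i < h.*2.+1) dig i * A (h.*2 - i) <=
            (\sum_(h.+1 <= i < h.*2.+1) dig i) * A h)%N.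
  rewrite big_distrl /= big_nat_cond [X in (_ <= X)%N]big_nat_cond.
  apply: leq_sum => i /andP[/andP[hi _] _].
  by rewrite leq_mul2l psum_dig_homo ?orbT //; lia.
by move: le1 le2; rewrite E2; nia.
Qed.

(** Horner form of [\sum_(k <= n) r k 2^(n-k)]. *)
Fixpoint conv_head (n : nat) : nat :=
  if n is m.+1 then (2 * conv_head m + r m.+1)%N else r 0.

(** The subtraction is truncated; it is exact once [conv_head n < 2 ^ n.+1]. *)
Definition carry (n : nat) : nat := (2 ^ n.+1 - conv_head n)%N.

Section PositiveCarry.

Hypothesis conv_head_lt : forall n, (conv_head n < 2 ^ n.+1)%N.

Lemma carry_gt0 n : (0 < carry n)%N.
Proof. by rewrite subn_gt0. Qed.

Lemma carryS n : (carry n.+1 + r n.+1 = 2 * carry n)%N.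
Proof.
have := conv_head_lt n; have := conv_head_lt n.+1.
by rewrite /carry /= [(2 ^ n.+2)%N]expnS; lia.
Qed.

Lemma odd_carry n : odd (carry n) = odd (r n).
Proof.
case: n => [|n].
  by have := conv_head_lt 0; rewrite /carry /=; lia.
by have := congr1 odd (carryS n); rewrite oddD mul2n odd_double; do 2 case: odd.
Qed.

(** A positive even carry is at least 2, and an odd one forces a one at [n./2]. *)
Lemma carry_ge2 n : (2 <= carry n + dig n./2)%N.
Proof.
have := carry_gt0 n; have := @odd_conv_dig n; rewrite -odd_carry.
by case: (a n./2) => /=; [|move=> /(_ _)/implyP]; lia.
Qed.

(** By [carryS], passing from [n] to [n.+1] raises the right side by [carry n + dig n./2], which is
    at least 2. *)
Lemma sum_conv_dig_ge n :
  (2 * n <= \sum_(k < n.+1) r k + carry n + \sum_(k < n) dig k./2)%N.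
Proof.
elim: n => [//|n IHn].
rewrite [X in (X + _ + _)%N]big_ord_recr [X in (_ + X)%N]big_ord_recr /=.
by move: IHn (carryS n) (carry_ge2 n) => /=; lia.
Qed.

End PositiveCarry.

Lemma sum_dig_half h : (\sum_(k < h.*2) dig k./2 <= 2 * A h)%N.
Proof.
suff -> : (\sum_(k < h.*2) dig k./2 = 2 * \sum_(k < h) dig k)%N.
  by rewrite leq_mul2l /= /psum big_ord_recr leq_addr.
elim: h => [|h IHh]; first by rewrite !big_ord0.
rewrite doubleS !big_ord_recr /= uphalf_double doubleK; move: IHh => /=; lia.
Qed.

End Digits.

(** * Carries and digit counts for the square root of 2 *)

Section Sqrt2.

Variables (R : realType) (a : nat -> bool).
Hypothesis ha : binary_expansion (Num.sqrt (2 : R)) a.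

Local Notation dig := (fun i : nat => nat_of_bool (a i)).
Local Notation A := (psum dig).
Local Notation term := (fun i : nat => (a i)%:R / 2 ^+ i : R).
Local Notation S := (psum term).
Local Notation x := (Num.sqrt (2 : R)).

Let x_ge0 : 0 <= x. Proof. exact: sqrtr_ge0. Qed.

Let xx : x ^+ 2 = 2. Proof. by rewrite sqr_sqrtr. Qed.

Let term_ge0 i : 0 <= term i.
Proof. by rewrite divr_ge0 ?exprn_ge0. Qed.

Let seriesE n : series term n.+1 = S n.
Proof. by rewrite /series /= big_mkord. Qed.

Lemma psum_term_le n : S n <= x.
Proof.
rewrite -(cvg_lim (@Rhausdorff R) ha) -seriesE.
apply: nondecreasing_cvgn_le; last by apply/cvg_ex; exists x.
by apply: nondecreasing_series => i _ _; exact: term_ge0.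
Qed.

(** [S n + 2 ^- n] is nonincreasing, since the next digit contributes at most half of [2 ^- n]; so
    it bounds all later partial sums and their limit. *)
Lemma psum_term_ge n : x <= S n + 2 ^- n.
Proof.
have step m k : S (m + k) + 2 ^- (m + k) <= S m + 2 ^- m.
  elim: k => [|k IHk]; first by rewrite addn0.
  rewrite addnS; apply: le_trans IHk; rewrite psumS -addrA lerD2l.
  have p0 : 0 < 2 ^- (m + k) :> R by rewrite invr_gt0 exprn_gt0.
  by rewrite exprS invfM; case: (a _) => /=; lra.
rewrite -{1}(cvg_lim (@Rhausdorff R) ha).
apply: limr_le; first by apply/cvg_ex; exists x.
exists n.+1 => // -[//|m] /= lt_nm.
rewrite seriesE; apply: le_trans (step n (m - n)%N); rewrite subnKC //.
by rewrite lerDl invr_ge0 exprn_ge0.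
Qed.

Lemma psum_term_nat n : exists p : nat, S n = p%:R / 2 ^+ n.
Proof.
elim: n => [|n [p IHn]]; first by exists (a 0); rewrite /psum big_ord1.
exists (2 * p + a n.+1)%N; rewrite psumS IHn natrD natrM exprS.
by field; rewrite expf_neq0 ?pnatr_eq0.
Qed.

(** Equality would give [p ^ 2 = 2 ^ (2n + 1)], whose 2-adic valuation would be both even and
    odd. *)
Lemma psum_term_neq n : S n != x.
Proof.
have [p ->] := psum_term_nat n; apply/eqP => /(congr1 (fun y => y ^+ 2)).
rewrite xx exprMn exprVn => /(congr1 (fun y => y * 2 ^+ n ^+ 2)).
rewrite mulfVK ?expf_neq0 ?pnatr_eq0 // -exprM -exprS -!natrX => /eqP.
rewrite eqr_nat => /eqP /(congr1 (logn 2)).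
by rewrite lognX pfactorK //; lia.
Qed.

Lemma conv_headE n : (conv_head a n)%:R = 2 ^+ n * \sum_(i < n.+1) term i * S (n - i).
Proof.
rewrite -(sum_conv term).
have conv_term k : 2 ^+ k * conv term k = (conv dig k)%:R.
  rewrite /conv raddf_sum mulr_sumr; apply: eq_bigr => i _ /=.
  have le_ik : (i <= k)%N by rewrite -ltnS.
  rewrite natrM -[in 2 ^+ k](subnKC le_ik) exprD.
  by field; rewrite ?expf_neq0 ?pnatr_eq0.
elim: n => [|n IHn]; first by rewrite big_ord1 conv_term.
rewrite [RHS](congr1 _ (big_ord_recr _ _)) /= natrD natrM IHn mulrDr conv_term.
by rewrite exprS mulrA.
Qed.

(** The truncated square is at most [S n * x], which is strictly below [x ^+ 2 = 2] because [S n]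
    never reaches [x]. *)
Lemma conv_head_lt n : (conv_head a n < 2 ^ n.+1)%N.
Proof.
rewrite -(ltr_nat R) natrX conv_headE exprSr ltr_pM2l ?exprn_gt0 //.
have lt_Sx : S n < x by rewrite lt_neqAle psum_term_neq psum_term_le.
have x_gt0 : 0 < x by rewrite sqrtr_gt0.
apply: (@le_lt_trans _ _ (S n * x)); last by rewrite -[ltRHS]xx expr2 ltr_pM2r.
rewrite /psum mulr_suml; apply: ler_sum => i _.
by apply: ler_wpM2l; [exact: term_ge0|exact: psum_term_le].
Qed.

(** Replacing each [S (n - i)] by [x - 2 ^- (n - i)] costs [A n] in total after scaling by [2 ^+ n];
    replacing [S n * x] by 2 costs at most [x <= 2]. *)
Lemma carry_le n : (carry a n <= A n + 2)%N.
Proof.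
have p0 : 0 < 2 ^+ n :> R by rewrite exprn_gt0.
rewrite -(ler_nat R) natrB; last exact: ltnW (conv_head_lt n).
rewrite natrX conv_headE natrD.
have : \sum_(i < n.+1) term i * (x - 2 ^- (n - i)) <=
       \sum_(i < n.+1) term i * S (n - i).
  apply: ler_sum => i _; apply: ler_wpM2l; first exact: term_ge0.
  by rewrite lerBlDr psum_term_ge.
have -> : \sum_(i < n.+1) term i * (x - 2 ^- (n - i)) =
          S n * x - (A n)%:R / 2 ^+ n.
  rewrite /psum raddf_sum !mulr_suml -sumrB; apply: eq_bigr => i _ /=.
  have le_in : (i <= n)%N by rewrite -ltnS.
  rewrite -[in 2 ^+ n](subnKC le_in) exprD.
  by field; rewrite ?expf_neq0 ?pnatr_eq0.
move=> /(ler_wpM2l (ltW p0)).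
rewrite mulrBr [_ * (_ / _)]mulrC divfK ?gt_eqF // => le1.
have /(ler_wpM2r x_ge0) := psum_term_ge n.
rewrite -expr2 xx => /(ler_wpM2l (ltW p0)).
rewrite mulrDl [leRHS]mulrDr mulVKf ?gt_eqF // => le2.
have lex : x <= 2 by rewrite -(@ler_pXn2r _ 2) ?nnegrE // xx; lra.
by rewrite exprSr; lra.
Qed.

Lemma psum_dig_quad h :
  (4 * h + A h ^ 2 <= 2 * A h.*2 * A h + A h.*2 + 2 * A h + 2)%N.
Proof.
have := sum_conv_dig_ge conv_head_lt h.*2; have := sum_conv_dig_le a h.
have := sum_dig_half a h; have := carry_le h.*2.
set s1 := (\sum_(k < _) _)%N; set s2 := (\sum_(k < _) _)%N; lia.
Qed.

(** Inserting the assumed bound at [h] and [h.*2] into [psum_dig_quad] makes a positive multiple of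
    [h] at most [O(sqrt h)]. *)
Lemma psum_dig_unbounded (c K : R) : 0 <= c -> 0 <= K ->
  c ^+ 2 * (2 * x - 1) < 4 ->
  ~ (forall n, (A n)%:R <= c * Num.sqrt n%:R + K).
Proof.
move=> c0 K0 hc hA.
have x1 : 1 <= x by rewrite -[leLHS]sqrtr1 ler_sqrt // ler1n.
pose d := 4 - c ^+ 2 * (2 * x - 1).
have d0 : 0 < d by rewrite subr_gt0.
pose B := 2 * c * K * x + c * x + 2 * c.
pose D := K ^+ 2 + 3 * K + 2.
have bound h : d * h%:R <= B * Num.sqrt h%:R + D.
  have := psum_dig_quad h; rewrite -(ler_nat R) !natrD natrX !natrM.
  have := hA h.*2; rewrite -mul2n natrM sqrtrM // mul2n => hU.
  have hV := hA h.
  set s := Num.sqrt (h%:R : R) in hU hV *.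
  have s0 : 0 <= s by exact: sqrtr_ge0.
  have -> : h%:R = s ^+ 2 :> R by rewrite sqr_sqrtr.
  have u0 : 0 <= (A h.*2)%:R :> R by [].
  have v0 : 0 <= (A h)%:R :> R by [].
  move: u0 v0 hU hV; set u : R := (A h.*2)%:R; set v : R := (A h)%:R.
  set U := c * (x * s) + K; set V := c * s + K => u0 v0 hU hV hq.
  have leVU : V <= U.
    by rewrite lerD2r ler_wpM2l // ler_peMl.
  have m1 : 2 * u * v <= 2 * U * v by rewrite ler_wpM2r // ler_wpM2l.
  (* [t |-> 2 U t - t^2] increases up to [U] *)
  have m2 : 2 * U * v - v ^+ 2 <= 2 * U * V - V ^+ 2 by nra.
  have UV : 2 * U * V - V ^+ 2 =
      c ^+ 2 * (2 * x - 1) * s ^+ 2 + 2 * c * K * x * s + K ^+ 2.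
    by rewrite /U /V; ring.
  have EU : U = c * x * s + K by rewrite /U mulrA.
  have EV : V = c * s + K by [].
  rewrite /d /B /D; lra.
have B0 : 0 <= B by rewrite !addr_ge0 ?mulr_ge0.
have D0 : 0 <= D by rewrite /D; nra.
(* With [h = m ^ 2] the root is [m], and [d * m > B + D + 1] with [m >= 1] gives
   [d * m ^ 2 > B * m + D]. *)
pose q := (B + D + 1) / d.
pose m := (Num.truncn q).+1.
have lt_qm : q < m%:R by exact: truncnS_gt.
have m1 : 1 <= m%:R :> R by rewrite ler1n.
have := bound (m ^ 2)%N; rewrite natrX sqrtr_sqr ger0_norm //.
move: lt_qm; rewrite ltr_pdivrMr // => lt_qm.
by move: (m%:R) m1 lt_qm => t *; nra.
Qed.

End Sqrt2.

Theorem theorem2 (R : realType) (a : nat -> bool)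
    (ha : binary_expansion (Num.sqrt (2 : R)) a) (eps : R) (heps : 0 < eps) :
  infinite_set [set N : nat | (0 < N)%N /\
    (2 / Num.sqrt (2 * Num.sqrt 2 - 1) - eps) * Num.sqrt (N%:R : R)
      <= (nz a N)%:R].
Proof.
set y := Num.sqrt (2 * Num.sqrt 2 - 1).
have x1 : 1 <= Num.sqrt (2 : R) by rewrite -[leLHS]sqrtr1 ler_sqrt // ler1n.
have y0 : 0 < y by rewrite sqrtr_gt0; lra.
have yy : y ^+ 2 = 2 * Num.sqrt 2 - 1 by rewrite sqr_sqrtr; lra.
set c := 2 / y - eps => /finite_seqP[s Es].
pose M := (\max_(i <- s) i)%N.
have gtM N : (M < N)%N -> (nz a N)%:R < c * Num.sqrt N%:R.
  move=> ltMN; rewrite ltNge; apply/negP => le_c.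
  have : [set` s] N by rewrite -Es; split => //; exact: leq_ltn_trans ltMN.
  move=> /= Ns; have := @leq_bigmax_seq _ s xpredT id N Ns isT.
  by rewrite leqNgt ltMN.
(* A negative [c] would make the count at [M.+1] negative. *)
have c0 : 0 <= c.
  have := gtM M.+1 (ltnSn _); rewrite leNgt => lt1; apply/negP => c_lt0.
  have : c * Num.sqrt (M.+1%:R : R) <= 0.
    by rewrite mulr_le0_ge0 ?sqrtr_ge0 ?ltW.
  by have : 0 <= (nz a M.+1)%:R :> R by []; lra.
(* The constant [M.+1] absorbs every [n <= M], where [A n <= n.+1], and the units digit for larger
   [n]. *)
apply: (@psum_dig_unbounded R a ha c (M.+1)%:R c0) => // [|n].
  have cy0 : 0 <= c * y by rewrite mulr_ge0 // ltW.
  have cy : c * y < 2.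
    by rewrite /c mulrBl divfK ?gt_eqF // ltrBlDr ltrDl mulr_gt0.
  by rewrite -yy -exprMn; nra.
have [le_nM|lt_Mn] := leqP n M.
  apply: (@le_trans _ _ M.+1%:R); last by rewrite lerDr mulr_ge0 ?sqrtr_ge0.
  rewrite ler_nat; apply: (@leq_trans n.+1) => //.
  rewrite /psum -[X in (_ <= X)%N]card_ord -sum1_card.
  by apply: leq_sum => i _; case: (a i).
rewrite psum_dig_nz natrD addrC lerD //; first exact: ltW (gtM n lt_Mn).
by rewrite ler_nat; case: (a 0).
Qed.
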